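(* Let $G$ be a weakly connected and weight-balanced weighted directed graph on $N$ nodes with Laplacian matrix $L$, and let $\Delta>0$. Consider the hybrid system (H) of consensus with hysteretic quantizers described in the context. For each $z_0\in X_0$ there exists a nontrivial solution $z(t,j)$ of (H) with $z(0,0)=z_0$, and such solution is complete and forward unique (any other solution of (H) with the same initial condition is the restriction of $z$ to its own hybrid time domain). Moreover, every interval $I_j=\{t:(t,j)\in\mathrm{dom}\,z\}$ (for those $j$ for which it is nonempty), possibly with the exception of $I_0$, has nonempty interior.
   Context: A weighted directed graph $G=(V,E,A)$ has node set $V=\{1,\dots,N\}$, edge set $E\subset V\times V$ without self-loops, and adjacency matrix $A\in\mathbb{R}_{\ge0}^{N\times N}$ with $A_{ij}>0$ if $(j,i)\in E$ and $A_{ij}=0$ otherwise. It is weight-balanced if $\sum_j A_{ij}=\sum_j A_{ji}$ for every $i$; weakly connected if any two nodes are joined by a path of edges, disregarding orientation. $L=\mathrm{diag}(A\mathbf 1)-A$ is the Laplacian, with $\mathbf 1$ the all-ones vector. Hybrid system (H). Let $Q=\Delta\mathbb{Z}\cup(\Delta\mathbb{Z}+\Delta/2)$ and $X=\mathbb{R}^N\times Q^N$, with states $z=(x,q)$. Let $C=\{(x,q)\in X:\ q_i-\frac\Delta2<x_i<q_i+\frac\Delta2\ \forall i\in V\}$ and $D=X\setminus C$, i.e. $D=\{(x,q)\in X:\exists i\in V,\ x_i\le q_i-\frac\Delta2\text{ or }x_i\ge q_i+\frac\Delta2\}$. On $C$ the state flows: $\dot z=f(z)$, i.e. $\dot x=-Lq$,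 $\dot q=0$. On $D$ the state jumps: $z^+=g(z)$, i.e. $x^+=x$ and, for each $i$, $q_i^+=q_i+\frac\Delta2$ if $x_i\ge q_i+\frac\Delta2$, $q_i^+=q_i-\frac\Delta2$ if $x_i\le q_i-\frac\Delta2$, $q_i^+=q_i$ otherwise. Initial conditions belong to $X_0=\{(x,q)\in X:\ q_i-\frac\Delta2\le x_i<q_i+\frac\Delta2\ \forall i\in V\}$. A hybrid time domain is a subset of $\mathbb{R}_{\ge0}\times\mathbb{N}$ that is the union of infinitely many intervals $[t_j,t_{j+1}]\times\{j\}$, $j=0,1,2,\dots$, with $0=t_0\le t_1\le t_2\le\cdots$, or of finitely many such intervals, with the last one possibly of the form $[t_j,t_{j+1}]\times\{j\}$, $[t_j,t_{j+1})\times\{j\}$ or $[t_j,+\infty)\times\{j\}$. A solution is a function $z(t,j)$ defined on a hybrid time domain $\mathrm{dom}\,z$, such that $t\mapsto z(t,j)$ is locally absolutely continuous on $I_j=\{t:(t,j)\in\mathrm{dom}\,z\}$ for each $j$, $z(0,0)\in C\cup D$, and: (a) for each $j$ such that $I_j$ has nonempty interior, $\dot z(t,j)=f(z(t,j))$ for a.e. $t\in I_j$ and $z(t,j)\in C$ for all $t\in[\min I_j,\sup I_j)$; (b) for each $(t,j)\in\mathrm{dom}\,z$ with $(t,j+1)\in\mathrm{dom}\,z$, $z(t,j)\in D$ and $z(t,j+1)=g(z(t,j))$. A solution is nontrivial if $\mathrm{dom}\,z$ contains at least one point different from $(0,0)$, and complete if $\mathrm{dom}\,z$ is unbounded. *)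

(* Defs.v *)
From HB Require Import structures.
From mathcomp Require Import all_boot all_order all_algebra.
From mathcomp Require Import all_classical all_reals all_analysis.

Set Implicit Arguments.
Unset Strict Implicit.
Unset Printing Implicit Defensive.

Import Order.TTheory GRing.Theory Num.Theory.
Import numFieldNormedType.Exports.

Local Open Scope classical_set_scope.
Local Open Scope ring_scope.

(** * Weighted directed graphs *)

(* [edge j i] means that (j, i) is an edge; the corresponding weight is
   [adj i j], with the indices in the opposite order. *)
Record wdigraph (R : realType) (N : nat) := WDigraph {
  edge : rel 'I_N;
  adj : 'M[R]_N;
  edge_irr : irreflexive edge;
  adj_gt0 : forall i j, edge j i -> 0 < adj i j;
  adj_eq0 : forall i j, ~~ edge j i -> adj i j = 0 }.

Definition weight_balanced (R : realType) (N : nat) (G : wdigraph R N) : Prop :=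
  forall i, \sum_j adj G i j = \sum_j adj G j i.

Definition weakly_connected (R : realType) (N : nat) (G : wdigraph R N) : Prop :=
  forall i j, connect [rel u v | edge G u v || edge G v u] i j.

Definition laplacian (R : realType) (N : nat) (G : wdigraph R N) : 'M[R]_N :=
  diag_mx (adj G *m (const_mx 1 : 'cV[R]_N))^T - adj G.

(** * Hybrid systems and their solutions *)

Definition hybrid_time_domain (R : realType) (S : set (R * nat)) : Prop :=
  exists t : nat -> R, [/\ t 0%N = 0, nondecreasing_seq t &
    S = \bigcup_j (`[t j, t j.+1] `*` [set j])
    \/ exists (J : nat) (last : set R),
         [\/ last = `[t J, t J.+1]%classic, last = `[t J, t J.+1[%classic
           | last = `[t J, +oo[%classic]
         /\ S = (\bigcup_(j in `I_J) (`[t j, t j.+1] `*` [set j]))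
                `|` (last `*` [set J])].

(* Absolute continuity on the compact interval [a, b]. *)
Definition abs_continuous (R : realType) (V : normedModType R)
    (a b : R) (f : R -> V) : Prop :=
  forall e : R, 0 < e -> exists2 d : R, 0 < d &
    forall (n : nat) (u v : 'I_n -> R),
      (forall k, [/\ a <= u k, u k <= v k & v k <= b]) ->
      trivIset setT (fun k => `]u k, v k[%classic) ->
      \sum_k (v k - u k) < d -> \sum_k `|f (v k) - f (u k)| < e.

Definition loc_abs_continuous (R : realType) (V : normedModType R)
    (I : set R) (f : R -> V) : Prop :=
  forall a b : R, `[a, b] `<=` I -> abs_continuous a b f.

Record hybrid_system (R : realType) (V : normedModType R) := HybridSystem {
  flow_set : set V;
  flow_map : V -> V;
  jump_set : set V;
  jump_map : V -> V }.

(* A function on a hybrid time domain: only the values of [arc_val] on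
   [arc_dom] are meaningful. *)
Record hybrid_arc (R : realType) (V : normedModType R) := HybridArc {
  arc_dom : set (R * nat);
  arc_val : R -> nat -> V }.

Definition arc_slice (R : realType) (V : normedModType R)
    (z : hybrid_arc V) (j : nat) : set R := [set t | arc_dom z (t, j)].

(* In the flow condition, the two-sided derivative of the totalized function
   agrees with the derivative within the slice at every interior point of the
   slice; the at most two endpoints are negligible. The bounds
   [min I_j <= t < sup I_j] are stated in the extended reals because I_j may be
   unbounded. *)
Definition solution (R : realType) (V : normedModType R)
    (H : hybrid_system V) (z : hybrid_arc V) : Prop :=
  [/\ hybrid_time_domain (arc_dom z),
      arc_dom z (0, 0%N) /\ (flow_set H `|` jump_set H) (arc_val z 0 0%N),
      forall j, loc_abs_continuous (arc_slice z j) (fun t => arc_val z t j),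
      forall j, (arc_slice z j)° !=set0 ->
        {ae @lebesgue_measure R, forall t, arc_slice z j t ->
           is_derive t (1 : R) (fun s => arc_val z s j)
                     (flow_map H (arc_val z t j))}
        /\ forall t : R,
             (ereal_inf (EFin @` arc_slice z j) <= t%:E)%E ->
             (t%:E < ereal_sup (EFin @` arc_slice z j))%E ->
             flow_set H (arc_val z t j)
    & forall t j, arc_dom z (t, j) -> arc_dom z (t, j.+1) ->
        jump_set H (arc_val z t j)
        /\ arc_val z t j.+1 = jump_map H (arc_val z t j)].

Definition nontrivial (R : realType) (V : normedModType R)
    (z : hybrid_arc V) : Prop :=
  exists2 p, arc_dom z p & p <> (0, 0%N).

Definition complete_arc (R : realType) (V : normedModType R)
    (z : hybrid_arc V) : Prop :=
  ~ bounded_set ((fun p : R * nat => (p.1, p.2%:R) : R^o * R^o) @` arc_dom z).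

Definition restriction_of (R : realType) (V : normedModType R)
    (z' z : hybrid_arc V) : Prop :=
  arc_dom z' `<=` arc_dom z
  /\ forall t j, arc_dom z' (t, j) -> arc_val z' t j = arc_val z t j.

Definition forward_unique (R : realType) (V : normedModType R)
    (H : hybrid_system V) (z : hybrid_arc V) : Prop :=
  forall z' : hybrid_arc V, solution H z' ->
    arc_val z' 0 0%N = arc_val z 0 0%N -> restriction_of z' z.

(** * Consensus with hysteretic quantizers *)

(* A state is a pair z = (x, q), with x = z.1 and q = z.2. *)
Definition state (R : realType) (N : nat) : normedModType R :=
  ('cV[R]_N * 'cV[R]_N)%type.

Definition quant_levels (R : realType) (Delta : R) : set R :=
  [set Delta * k%:~R | k in [set: int]]
  `|` [set Delta * k%:~R + Delta / 2 | k in [set: int]].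

Definition state_space (R : realType) (N : nat) (Delta : R)
    : set (state R N) :=
  [set z : state R N | forall i : 'I_N, quant_levels Delta (z.2 i 0)].

Definition cons_flow_set (R : realType) (N : nat) (Delta : R)
    : set (state R N) :=
  [set z : state R N | state_space Delta z
    /\ forall i : 'I_N, z.2 i 0 - Delta / 2 < z.1 i 0 < z.2 i 0 + Delta / 2].

Definition cons_jump_set (R : realType) (N : nat) (Delta : R)
    : set (state R N) :=
  state_space Delta `\` cons_flow_set Delta.

Definition cons_flow_map (R : realType) (N : nat) (G : wdigraph R N)
    (z : state R N) : state R N :=
  (- (laplacian G *m z.2), 0).

Definition cons_jump_map (R : realType) (N : nat) (Delta : R)
    (z : state R N) : state R N :=
  (z.1, \col_i (if z.2 i 0 + Delta / 2 <= z.1 i 0 then z.2 i 0 + Delta / 2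
                else if z.1 i 0 <= z.2 i 0 - Delta / 2 then z.2 i 0 - Delta / 2
                else z.2 i 0)).

Definition consensus_system (R : realType) (N : nat) (G : wdigraph R N)
    (Delta : R) : hybrid_system (state R N) :=
  HybridSystem (cons_flow_set Delta) (cons_flow_map G)
               (cons_jump_set Delta) (cons_jump_map Delta).

Definition initial_states (R : realType) (N : nat) (Delta : R)
    : set (state R N) :=
  [set z : state R N | state_space Delta z
    /\ forall i : 'I_N, z.2 i 0 - Delta / 2 <= z.1 i 0 < z.2 i 0 + Delta / 2].

(* Main.v *)
Require Import Defs.
From HB Require Import structures.
From mathcomp Require Import all_boot all_order all_algebra.
From mathcomp Require Import all_classical all_reals all_analysis.
From mathcomp Require Import lra.

(** On a flow interval [q] is constant, so [x] moves along a straight line until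
    the first time at which the state leaves the open flow set. At that time
    [x] is still in the closed cell around [q], and one jump moves each
    coordinate sitting on the boundary to the center of its new cell: the
    jumped state lies in the flow set, which is open along flows, and the next
    flow interval has positive length. Iterating from [z0] gives either
    infinitely many jumps or a last, unbounded flow interval, hence a complete
    solution; accumulation of the jump times need not be excluded. Uniqueness
    holds because an absolutely continuous function with almost everywhere
    constant derivative is affine (applied first to [q], then to [(x, q)]), and
    because the flow and jump sets are disjoint, which forces the jump times. *)

Set Implicit Arguments.
Unset Strict Implicit.
Unset Printing Implicit Defensive.

Import Order.TTheory GRing.Theory Num.Theory.
Import numFieldNormedType.Exports.

Local Open Scope classical_set_scope.
Local Open Scope ring_scope.

(** * Absolutely continuous functions with almost everywhere constant derivative *)

(** The supremum of the points of [[a, b]] satisfying [P] satisfies [P] by the left clause, and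
    equals [b] because the right clause would otherwise go past it. *)
Lemma real_induction (R : realType) (P : R -> Prop) (a b : R) :
  a <= b -> P a ->
  (forall s, a <= s <= b -> exists2 d, 0 < d &
    (forall u, a <= u -> s - d < u <= s -> P u -> P s) /\
    (forall v, v <= b -> s <= v < s + d -> P s -> P v)) ->
  P b.
Proof.
move=> leab Pa step; pose T := [set c | a <= c <= b /\ P c].
have Ta : T a by split => //; rewrite lexx.
have Tub c : T c -> c <= sup T.
  by move=> Tc; apply: ub_le_sup => //; exists b => x [/andP[]].
have supab : a <= sup T <= b.
  by rewrite Tub//= ge_sup//; [exists a | move=> x [/andP[]]].
have [d d0 [left right]] := step _ supab.
have Psup : P (sup T).
  have [|c Tc dc] := @sup_adherent _ T d d0.
    by split; [exists a | exists b => x [/andP[]]].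
  case: (Tc) => /andP[ac _] Pc.
  by apply: (left c) => //; rewrite dc Tub.
have [bsup|supb] := leP b (sup T).
  by have <- : sup T = b by apply/eqP; rewrite eq_le bsup (andP supab).2.
pose v := Order.min b (sup T + d / 2).
have supv : sup T < v by rewrite /v lt_min supb/=; lra.
have vb : v <= b by rewrite /v ge_min lexx.
have /Tub : T v; last by rewrite leNgt supv.
split; first by rewrite vb (le_trans (andP supab).1)// ltW.
apply: right => //; rewrite (ltW supv)/= /v gt_min; apply/orP; right; lra.
Qed.

(** Multiplying out the difference quotient gives a comparison of norms, which passes to the
    component [q] and also holds at [u = t]. *)
Lemma is_derive_approx (R : realType) (V : normedModType R) (f : R -> V)
    (t : R) (w : V) : is_derive t (1 : R) f w ->
  forall e, 0 < e ->
    \forall u \near t, `|f u - f t - (u - t) *: w| <= e * `|u - t|.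
Proof.
move=> [df dw] e e0.
have : h^-1 *: (f (h + t) - f t) @[h --> (0 : R)^'] --> w.
  rewrite -dw; move: df; rewrite /derivable/derive.
  by under eq_fun do rewrite [_ *: 1]mulr1.
move/cvgrPdist_le => /(_ e e0) /nbhs_ballP[d /= d0 hd].
apply/nbhs_ballP; exists d => //= u; rewrite /ball/= distrC => ud.
have [->|ut] := eqVneq u t; first by rewrite !subrr scale0r subr0 !normr0 mulr0.
have ut0 : u - t != 0 by rewrite subr_eq0.
have := hd (u - t); rewrite /ball/= sub0r normrN => /(_ ud ut0).
rewrite subrK => h.
have -> : f u - f t - (u - t) *: w
    = - (u - t) *: (w - (u - t)^-1 *: (f u - f t)).
  by rewrite scalerBr !scaleNr scalerA divff// scale1r opprK addrC.
by rewrite normrZ normrN mulrC ler_wpM2r.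
Qed.

(** Lebesgue measure is additive on the disjoint intervals and monotone; this supplies the smallness
    that absolute continuity asks for. *)
Lemma disjoint_itv_length_lt (R : realType) (U : set R) (d : R) (n : nat)
    (u v : 'I_n -> R) :
  open U -> (lebesgue_measure U < d%:E)%E ->
  (forall k, u k <= v k) -> (forall k, `]u k, v k[ `<=` U) ->
  trivIset setT (fun k => `]u k, v k[%classic) ->
  \sum_k (v k - u k) < d.
Proof.
move=> oU Ud uv subU triv; rewrite -lte_fin; apply: le_lt_trans Ud.
have mF k : measurable (`]u k, v k[%classic : set R) by [].
have -> : (\sum_k (v k - u k))%:E =
    lebesgue_measure (\big[setU/set0]_(k < n) `]u k, v k[%classic).
  rewrite (measure_bigsetU_ord lebesgue_measure) // -sumEFin.
  apply: eq_bigr => k _.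
  apply: etrans (esym (lebesgue_measure_itv `]u k, v k[)) => /=; rewrite lte_fin.
  by have := uv k; rewrite le_eqVlt => /predU1P[->|->]; rewrite ?ltxx ?subrr.
apply: le_measure; rewrite ?inE.
- exact: bigsetU_measurable.
- exact: measurable_realfun.open_measurable.
- by rewrite -bigcup_pred => x [k _] /subU.
Qed.

(* The null set where the derivative fails is enclosed in an open set [U] so
   small that absolute continuity bounds the total increment of [f] over
   disjoint intervals of [U]. Real induction then splits [a, b] into finitely
   many intervals that either lie in [U] (recorded in the list [s]) or have a
   point at which the derivative estimate controls the increment. *)
Lemma abs_continuous_affine (R : realType) (V : normedModType R) (a b : R)
    (f : R -> V) (w : V) :
  a <= b -> abs_continuous a b f ->
  {ae @lebesgue_measure R, forall t, a < t < b -> forall e, 0 < e ->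
     \forall u \near t, `|f u - f t - (u - t) *: w| <= e * `|u - t|} ->
  f b = f a + (b - a) *: w.
Proof.
move=> leab acf aef; apply/eqP; rewrite addrC -subr_eq -subr_eq0 -normr_le0.
apply/ler_addgt0Pl => e e0; rewrite addr0.
(* The final error is at most [e1 * (b - a)] from derivative points, [e1] from absolute continuity,
   and [e1] times the norm of [w] from the total length inside [U]. *)
pose e1 := e / (2 + (b - a) + `|w|).
have D0 : 0 < 2 + (b - a) + `|w|.
  by rewrite ltr_wpDr// ltr_wpDr// subr_ge0.
have e10 : 0 < e1 by rewrite divr_gt0.
have [d d0 acd] := acf e1 e10.
pose d1 := Order.min d e1.
have d10 : 0 < d1 by rewrite lt_min d0.
pose P (t : R) := a < t < b -> forall e, 0 < e ->
  \forall u \near t, `|f u - f t - (u - t) *: w| <= e * `|u - t|.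
(* [P] is vacuous at the endpoints, so they are added to [N]: a point of [[a, b]] outside [U] is
   then interior and the derivative estimate applies there. *)
pose N := ~` P `|` ([set a] `|` [set b]).
have /negligible_outer_measure N0 : (@lebesgue_measure R).-negligible N.
  apply: negligibleU => //; apply: negligibleU; apply/negligibleP => //;
    exact: lebesgue_measure_set1.
have [U [oU NU]] :=
  @outer_measure_open_le R N (d1 / 2) ltac:(by rewrite divr_gt0).
rewrite N0 add0e => muU.
have {}muU : (lebesgue_measure U < d1%:E)%E.
  by apply: le_lt_trans muU _; rewrite lte_fin; lra.
(* Invariant of the real induction: pieces listed in [s] contribute their increment and their slope
   term separately, and everything else costs at most [e1] per unit length. *)
pose good (c : R) (s : seq (R * R)) := [/\
  all (fun p => a <= p.1 <= p.2) s /\ all (fun p => p.2 <= c) s,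
  pairwise (fun p q => p.2 <= q.1) s,
  {in s, forall p, `]p.1, p.2[ `<=` U} &
  `|f c - f a - (c - a) *: w| <= e1 * (c - a) +
     \sum_(p <- s) (`|f p.2 - f p.1| + (p.2 - p.1) * `|w|)].
have step_diff c c' s : c <= c' ->
    `|f c' - f c - (c' - c) *: w| <= e1 * (c' - c) -> good c s -> good c' s.
  move=> cc' le1 [[s1 s2] s3 s4 s5]; split => //.
    by split => //; apply: sub_all s2 => p /le_trans; apply.
  have -> : f c' - f a - (c' - a) *: w =
      (f c' - f c - (c' - c) *: w) + (f c - f a - (c - a) *: w).
    by rewrite [RHS]addrACA -opprD -scalerDl !addrA !subrK.
  by rewrite (le_trans (ler_normD _ _))// (le_trans (lerD le1 s5))//; lra.
have step_open c c' s : a <= c <= c' -> `]c, c'[ `<=` U -> good c s ->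
    good c' (rcons s (c, c')).
  move=> acc' sub [[s1 s2] s3 s4 s5]; have cc' := (andP acc').2; split.
  - rewrite !all_rcons /= s1 lexx acc'; split => //.
    by apply: sub_all s2 => p /le_trans; apply.
  - by rewrite pairwise_rcons s3 andbT.
  - by move=> p; rewrite mem_rcons inE => /predU1P[->//|/s4].
  rewrite big_rcons/=.
  have -> : f c' - f a - (c' - a) *: w =
      (f c' - f c) + ((c - c') *: w) + (f c - f a - (c - a) *: w).
    rewrite addrACA [f c' - f c + _]addrA subrK -scalerBl; congr (_ + _).
    by rewrite -scaleNr; congr (_ *: _); lra.
  apply: le_trans (ler_normD _ _) _; apply: le_trans (lerD (ler_normD _ _) s5) _.
  rewrite normrZ (distrC c) (ger0_norm (x := c' - c)) ?subr_ge0//.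
  have : 0 <= e1 * (c' - c) by rewrite mulr_ge0 ?subr_ge0// ltW.
  by lra.
have [|c asb|s [[s1 s2] s3 s4 s5]] :=
  @real_induction R (fun c => exists s, good c s) a b leab.
- exists [::]; split => //.
  by rewrite !subrr scale0r subrr normr0 big_nil mulr0 addr0.
- have [Uc|nUc] := pselect (U c).
    have /nbhs_ballP[r /= r0 rU] : nbhs c U by exact: open_nbhs_nbhs.
    exists r => //; split=> [u au /andP[ru uc]|v vb /andP[cv vr]] [s gs].
      exists (rcons s (u, c)); apply: step_open gs; rewrite ?au//.
      move=> x; rewrite /= in_itv/= => /andP[ux xc]; apply: rU.
      by rewrite /ball/= ltr_norml; lra.
    exists (rcons s (c, v)); apply: step_open gs; rewrite ?(andP asb).1//.
    move=> x; rewrite /= in_itv/= => /andP[ux xc]; apply: rU.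
    by rewrite /ball/= ltr_norml; lra.
  have acb : a < c < b.
    rewrite !lt_neqAle (andP asb).1 (andP asb).2 !andbT; apply/andP; split.
      by apply: contra_notN nUc => /eqP <-; apply: NU; right; left.
    by apply: contra_notN nUc => /eqP ->; apply: NU; right; right.
  have : P c by apply: contrapT => nP; apply: nUc; apply: NU; left.
  move=> /(_ acb e1 e10) /nbhs_ballP[r /= r0 rU].
  exists r => //; split=> [u au /andP[ru uc]|v vb /andP[cv vr]] [s gs].
    exists s; apply: step_diff gs => //.
    have := rU u; rewrite /ball/= ltr_norml => /(_ ltac:(lra)).
    rewrite [`|u - c|]distrC (ger0_norm (x := c - u)) ?subr_ge0//.
    rewrite -normrN; congr (`|_| <= _).
    by rewrite !opprD !opprK -scaleNr opprB [- f u + _]addrC.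
  exists s; apply: step_diff gs => //.
  have := rU v; rewrite /ball/= ltr_norml => /(_ ltac:(lra)).
  by rewrite (ger0_norm (x := v - c)) ?subr_ge0.
pose p k := nth (0, 0) s k.
pose u (k : 'I_(size s)) := (p k).1; pose v (k : 'I_(size s)) := (p k).2.
have ps (k : 'I_(size s)) : p k \in s by rewrite mem_nth.
have uv k : a <= u k <= v k by exact: (allP s1).
have vb k : v k <= b by exact: (allP s2).
have triv : trivIset setT (fun k => `]u k, v k[%classic).
  suff H (i j : 'I_(size s)) : (i < j)%N -> `]u i, v i[ `&` `]u j, v j[ = set0 :> set R.
    apply/trivIsetP => i j _ _; rewrite -val_eqE neq_ltn => /orP[]; first exact: H.
    by rewrite setIC; exact: H.
  move=> ij; apply/seteqP; split => // x [] /=; rewrite !in_itv/=.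
  have := pairwiseP (0, 0) s3 i j (ltn_ord i) (ltn_ord j) ij.
  by rewrite -/(p i) -/(p j) -/(v i) -/(u j); lra.
have len : \sum_k (v k - u k) < d1.
  apply: (disjoint_itv_length_lt oU muU _ _ triv).
    by move=> k; case/andP: (uv k).
  by move=> k; exact: s4.
have : \sum_k `|f (v k) - f (u k)| < e1.
  apply: acd => //; last by rewrite (lt_le_trans len)// /d1 ge_min lexx.
  by move=> k; split=> //; case/andP: (uv k).
have lenE : \sum_k (v k - u k) < e1.
  by rewrite (lt_le_trans len)// /d1 ge_min lexx orbT.
move: s5; rewrite (big_nth (0, 0)) big_mkord big_split/= -mulr_suml.
move=> s5 s6; apply: (le_trans s5).
have -> : e = e1 * (2 + (b - a) + `|w|) by rewrite /e1 divfK// gt_eqF.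
have : (\sum_k (v k - u k)) * `|w| <= e1 * `|w| by rewrite ler_wpM2r// ltW.
rewrite /u /v /p in s6 *; lra.
Qed.

(** * Flow lines, exit times and jumps from the closed cell *)

(** [cons_flow_map] depends only on [q] and leaves [q] at rest, so this line is the exact flow; it
    is defined for all real [s], also past the exit from the flow set. *)
Definition cons_flow (R : realType) (N : nat) (G : wdigraph R N)
    (z : state R N) (s : R) : state R N := z + s *: cons_flow_map G z.

Definition exit_times (R : realType) (N : nat) (G : wdigraph R N) (Delta : R)
    (z : state R N) : set R :=
  [set s | 0 <= s /\ ~ cons_flow_set Delta (cons_flow G z s)].

(* Junk value 0 when the flow set is never left, since [inf set0 = 0]. *)
Definition exit_time (R : realType) (N : nat) (G : wdigraph R N) (Delta : R)
    (z : state R N) : R := inf (exit_times G Delta z).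

(** Both bounds are weak because a flow may exit through either side of the cell. The set contains
    the initial states and is preserved by a flow up to exit followed by a jump. *)
Definition closed_cell (R : realType) (N : nat) (Delta : R)
    : set (state R N) :=
  [set z : state R N | state_space Delta z
    /\ forall i : 'I_N, z.2 i 0 - Delta / 2 <= z.1 i 0 <= z.2 i 0 + Delta / 2].

Lemma cons_flow0 (R : realType) (N : nat) (G : wdigraph R N) (z : state R N) :
  cons_flow G z 0 = z.
Proof. by rewrite /cons_flow scale0r addr0. Qed.

Lemma cons_flow_snd (R : realType) (N : nat) (G : wdigraph R N)
    (z : state R N) (s : R) : (cons_flow G z s).2 = z.2.
Proof. by rewrite /cons_flow/= scaler0 addr0. Qed.

Lemma cons_flow_fst (R : realType) (N : nat) (G : wdigraph R N)
    (z : state R N) (s : R) (i : 'I_N) :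
  (cons_flow G z s).1 i 0 = z.1 i 0 + s * (cons_flow_map G z).1 i 0.
Proof. by rewrite /cons_flow/= !mxE. Qed.

Lemma cons_flow_map_flow (R : realType) (N : nat) (G : wdigraph R N)
    (z : state R N) (s : R) :
  cons_flow_map G (cons_flow G z s) = cons_flow_map G z.
Proof. by rewrite /cons_flow_map cons_flow_snd. Qed.

Lemma flow_set_cons_flow (R : realType) (N : nat) (G : wdigraph R N)
    (Delta : R) (z : state R N) (s : R) :
  cons_flow_set Delta (cons_flow G z s) <-> state_space Delta z /\
    forall i, z.2 i 0 - Delta / 2 <
      z.1 i 0 + s * (cons_flow_map G z).1 i 0 < z.2 i 0 + Delta / 2.
Proof.
rewrite /cons_flow_set /state_space /= !scaler0 !addr0.
by split=> -[H1 H2]; split=> // i; have := H2 i; rewrite !mxE.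
Qed.

(** Since [q] is fixed along the line, only finitely many strict inequalities, continuous in [u],
    have to persist. *)
Lemma near_flow_set (R : realType) (N : nat) (G : wdigraph R N) (Delta : R)
    (z : state R N) (s : R) : cons_flow_set Delta (cons_flow G z s) ->
  \forall u \near s, cons_flow_set Delta (cons_flow G z u).
Proof.
move=> /flow_set_cons_flow[zS zs].
pose h (i : 'I_N) (u : R) := z.1 i 0 + u * (cons_flow_map G z).1 i 0.
have : \forall u \near s, forall i,
    h i u \in `]z.2 i 0 - Delta / 2, z.2 i 0 + Delta / 2[.
  apply: (@filter_forall R 'I_N (fun i => [set u | h i u \in _]) (nbhs s) _) => i.
  have hc : h i u @[u --> s] --> h i s.
    by apply: cvgD; [exact: cvg_cst | apply: cvgM; [exact: cvg_id | exact: cvg_cst]].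
  have hs : h i s \in `]z.2 i 0 - Delta / 2, z.2 i 0 + Delta / 2[.
    by rewrite in_itv; exact: zs.
  exact: hc (near_in_itvoo hs).
by apply: filterS => u hu; apply/flow_set_cons_flow; split.
Qed.

Lemma exit_times_ge (R : realType) (N : nat) (G : wdigraph R N)
    (Delta : R) (z : state R N) (s : R) :
  exit_times G Delta z s -> exit_time G Delta z <= s.
Proof. by apply: ge_inf; exists 0 => x []. Qed.

Lemma exit_time_ge0 (R : realType) (N : nat) (G : wdigraph R N)
    (Delta : R) (z : state R N) : 0 <= exit_time G Delta z.
Proof.
have [E0|/set0P nE] := eqVneq (exit_times G Delta z) set0.
  by rewrite /exit_time E0 inf0.
by apply: lb_le_inf => // x [].
Qed.

(** The bound on [s] is conditional because [exit_time] is a junk value when the flow set is never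
    left. *)
Lemma flow_before_exit (R : realType) (N : nat) (G : wdigraph R N)
    (Delta : R) (z : state R N) (s : R) : 0 <= s ->
  (exit_times G Delta z !=set0 -> s < exit_time G Delta z) ->
  cons_flow_set Delta (cons_flow G z s).
Proof.
move=> s0 H; apply: contrapT => nC.
have Es : exit_times G Delta z s by [].
by have := H (ex_intro _ s Es); rewrite ltNge exit_times_ge.
Qed.

(** The infimum is attained: a state still in the flow set at [exit_time] would stay there at nearby
    times, yet exit times come arbitrarily close. *)
Lemma exit_timeP (R : realType) (N : nat) (G : wdigraph R N)
    (Delta : R) (z : state R N) : exit_times G Delta z !=set0 ->
  exit_times G Delta z (exit_time G Delta z).
Proof.
move=> nE; split; first exact: exit_time_ge0.
move=> /near_flow_set /nbhs_ballP[d /= d0 dC].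
have [|s Es sd] := @inf_adherent _ (exit_times G Delta z) d d0.
  by split=> //; exists 0 => x [].
case: (Es) => _; apply; apply: dC.
have := exit_times_ge Es; rewrite /exit_time in sd *.
by rewrite /ball/= ltr_norml; lra.
Qed.

Lemma exit_time_gt0 (R : realType) (N : nat) (G : wdigraph R N)
    (Delta : R) (z : state R N) : cons_flow_set Delta z ->
  exit_times G Delta z !=set0 -> 0 < exit_time G Delta z.
Proof.
move=> Cz /exit_timeP[]; rewrite le_eqVlt => /predU1P[<-|//].
by rewrite cons_flow0.
Qed.

(** No limit is taken: a value above [y] at [t] forces [v > 0], and then the level [y] is attained
    at [(y - x) / v], before [t]. *)
Lemma affine_le (R : realType) (x v y t : R) : 0 < t ->
  (forall s, 0 <= s < t -> x + s * v < y) -> x + t * v <= y.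
Proof.
move=> t0 H; rewrite leNgt; apply/negP => yt.
have xy : x < y by have := H 0; rewrite lexx t0 => /(_ isT); lra.
have v0 : 0 < v by rewrite ltNge; apply/negP => v0; nra.
have sv : (y - x) / v * v = y - x by rewrite divfK ?gt_eqF.
suff /H : 0 <= (y - x) / v < t by rewrite sv; lra.
rewrite divr_ge0 ?(ltW v0) ?subr_ge0 ?(ltW xy)//= ltr_pdivrMr//; lra.
Qed.

(** The strict bounds before the exit become weak at the exit; the lower one is [affine_le] for the
    negated coordinate. A zero exit time, junk or not, leaves [z] in place. *)
Lemma closed_cell_exit (R : realType) (N : nat) (G : wdigraph R N)
    (Delta : R) (z : state R N) :
  closed_cell Delta z ->
  closed_cell Delta (cons_flow G z (exit_time G Delta z)).
Proof.
move=> cz; case: (cz) => zS zi.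
have := exit_time_ge0 G Delta z; rewrite le_eqVlt => /predU1P[<-|t0].
  by rewrite cons_flow0.
have inC s : 0 <= s < exit_time G Delta z ->
    cons_flow_set Delta (cons_flow G z s).
  by move=> /andP[s0 st]; apply: flow_before_exit.
split=> [i|i]; first by rewrite cons_flow_snd.
rewrite cons_flow_snd cons_flow_fst.
set t := exit_time G Delta z in t0 inC *; set v := (cons_flow_map G z).1 i 0.
have {}inC s : 0 <= s < t ->
    z.2 i 0 - Delta / 2 < z.1 i 0 + s * v < z.2 i 0 + Delta / 2.
  by move/inC/flow_set_cons_flow => [_]; apply.
have up := affine_le (y := z.2 i 0 + Delta / 2) t0.
have lo := affine_le (x := - z.1 i 0) (v := - v) (y := - (z.2 i 0 - Delta / 2)) t0.
apply/andP; split.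
  suff : - z.1 i 0 + t * - v <= - (z.2 i 0 - Delta / 2) by lra.
  by apply: lo => s /inC; lra.
by apply: up => s /inC; lra.
Qed.

Lemma quant_levels_shift (R : realType) (Delta y : R) :
  quant_levels Delta y ->
  quant_levels Delta (y + Delta / 2) /\ quant_levels Delta (y - Delta / 2).
Proof.
move=> [[k _ <-]|[k _ <-]]; split; [right|right|left|left].
- by exists k.
- by exists (k - 1) => //; rewrite rmorphB/=; lra.
- by exists (k + 1) => //; rewrite rmorphD/=; lra.
- by exists k => //; lra.
Qed.

(** In the closed cell a threshold is met only with equality, so a coordinate that switches gets
    [q_i = x_i]; the others are already strictly inside. *)
Lemma cons_jump_flow_set (R : realType) (N : nat) (Delta : R)
    (z : state R N) : 0 < Delta -> closed_cell Delta z ->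
  cons_flow_set Delta (cons_jump_map Delta z).
Proof.
move=> D0 [zS zi]; split=> i; rewrite /cons_jump_map/= mxE.
  have [up down] := quant_levels_shift (zS i).
  by case: ifP => // _; case: ifP.
have /andP[lo hi] := zi i.
by case: ifPn => [|/negP]; [|case: ifPn => [|/negP]]; lra.
Qed.

Lemma initial_closed_cell (R : realType) (N : nat) (Delta : R)
    (z : state R N) : initial_states Delta z -> closed_cell Delta z.
Proof. by move=> [zS zi]; split=> // i; case/andP: (zi i) => -> /ltW. Qed.

(** * Structure of arbitrary solutions *)

(** The four shapes of a domain are reduced to what induction on the jump count needs: a slice is
    traversed from time 0, or from a point [b] shared with the preceding slice. *)
Lemma hybrid_time_domain_slices (R : realType) (S : set (R * nat)) :
  hybrid_time_domain S ->
  (forall t, S (t, 0%N) -> 0 <= t /\ forall s, 0 <= s <= t -> S (s, 0%N)) /\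
  (forall t j, S (t, j.+1) -> exists b,
     [/\ b <= t, S (b, j) & forall s, b <= s <= t -> S (s, j.+1)]).
Proof.
move=> [t [t0 tnd]] [->|[J [last [lastP ->]]]].
  split=> [u [j _ [/= + /= j0]]|u j [k _ [/= + /= kj]]].
    rewrite -j0 in_itv/= t0 => /andP[u0 u1]; split=> // s /andP[s0 su].
    by exists 0%N => //; split=> //=; rewrite in_itv/= t0 s0 (le_trans su).
  rewrite in_itv/= -kj => /andP[u0 u1]; exists (t j.+1); split=> //.
    by exists j => //; split=> //=; rewrite in_itv/= lexx andbT tnd.
  move=> s /andP[s0 su].
  by exists j.+1 => //; split=> //=; rewrite in_itv/= s0 (le_trans su).
(* The two properties of the last interval used below, common to its three shapes. *)
have lastge u : last u -> t J <= u.
  by case: lastP => -> /=; rewrite in_itv/= ?andbT => // /andP[].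
have lastle u s : last u -> t J <= s <= u -> last s.
  case: lastP => -> /=; rewrite !in_itv/= ?andbT.
  - by move=> /andP[_ uJ] /andP[-> su]; rewrite (le_trans su).
  - by move=> /andP[_ uJ] /andP[-> su]; rewrite (le_lt_trans su).
  - by move=> _ /andP[].
split=> [u [[j /= jJ [/= + /= j0]]|[/= lu /= J0]]
        |u j [[k /= kJ [/= + /= kj]]|[/= lu /= Jj]]].
- move: jJ; rewrite -j0 in_itv/= t0 => J0 /andP[u0 u1].
  split=> // s /andP[s0 su]; left; exists 0%N => //.
  by split=> //=; rewrite in_itv/= t0 s0 (le_trans su).
- have := lastge _ lu; rewrite -J0 t0 => u0; split=> // s su.
  by right; split=> //=; apply: lastle lu _; rewrite -J0 t0.
- move: kJ; rewrite -kj in_itv/= => jJ /andP[u0 u1].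
  exists (t j.+1); split=> //.
    left; exists j; first exact: ltnW.
    by split=> //=; rewrite in_itv/= lexx andbT tnd.
  move=> s /andP[s0 su]; left; exists j.+1 => //.
  by split=> //=; rewrite in_itv/= s0 (le_trans su).
- exists (t J); split; first exact: lastge.
    left; exists j; first by rewrite /= -Jj.
    by split=> //=; rewrite in_itv/= -Jj lexx andbT tnd.
  by move=> s su; right; split=> //=; exact: lastle lu su.
Qed.

Lemma abs_continuousW (R : realType) (V : normedModType R) (a b c : R)
    (f : R -> V) : c <= b -> abs_continuous a b f -> abs_continuous a c f.
Proof.
move=> cb acf e /acf[d d0 H]; exists d => // n u v uv; apply: H => k.
by have [? ? vc] := uv k; split=> //; exact: le_trans cb.
Qed.

Lemma solution_segment (R : realType) (N : nat) (G : wdigraph R N)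
    (Delta : R) (z : hybrid_arc (state R N)) (j : nat) (a b : R) :
  solution (consensus_system G Delta) z -> a <= b ->
  (forall s, a <= s <= b -> arc_slice z j s) ->
  forall s, a <= s <= b ->
    arc_val z s j = cons_flow G (arc_val z a j) (s - a) /\
    (s < b -> cons_flow_set Delta (arc_val z s j)).
Proof.
move=> [_ _ acz flowz _] leab slice s /andP[as_ sb].
(* When [a = b] the slice may have empty interior, so the flow condition is silent, but the claim is
   trivial. *)
move: leab; rewrite le_eqVlt => /predU1P[ab|ltab].
  have -> : s = a by apply/eqP; rewrite eq_le as_ ab sb.
  by rewrite subrr cons_flow0 ab ltxx.
have [aez inC] : {ae @lebesgue_measure R, forall t, arc_slice z j t ->
    is_derive t (1 : R) (fun s => arc_val z s j)
      (cons_flow_map G (arc_val z t j))} /\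
    forall t, a <= t < b -> cons_flow_set Delta (arc_val z t j).
  have [|aez inC] := flowz j.
    exists ((a + b) / 2).
    have ab2 : (a + b) / 2 \in `]a, b[ by rewrite in_itv/=; lra.
    apply: filterS (near_in_itvoo ab2) => x; rewrite in_itv/= => abx.
    by apply: slice; lra.
  split=> // t /andP[at_ tb]; apply: inC.
    by apply: ereal_inf_lbound; exists t => //; apply: slice; lra.
  apply: (@lt_le_trans _ _ b%:E); first by rewrite lte_fin.
  by apply: ereal_sup_ubound; exists b => //; apply: slice; lra.
have acab : abs_continuous a b (fun s => arc_val z s j).
  by apply: acz => t; rewrite /= in_itv/=; exact: slice.
(* The slope of [x] depends on [q]. Constancy of [q], obtained first with slope 0, makes the
   derivative of the full state almost everywhere constant. *)
have qE t : a <= t <= b -> (arc_val z t j).2 = (arc_val z a j).2.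
  move=> /andP[at_ tb].
  rewrite (@abs_continuous_affine R _ a t (fun s => (arc_val z s j).2) 0) //.
  - by rewrite scaler0 addr0.
  - move=> e e0; have [d d0 H] := abs_continuousW tb acab e0; exists d => //.
    move=> n u v uv triv len; apply: le_lt_trans (H n u v uv triv len).
    by apply: ler_sum => k _; rewrite [leRHS]prod_normE le_max lexx orbT.
  - apply: (@filterS _ (almost_everywhere _) _ _ _ _ aez) => x H /andP[ax xt] e e0.
    have /is_derive_approx/(_ e e0) := H (slice x ltac:(lra)).
    apply: filterS => u; apply: le_trans.
    by rewrite [leRHS]prod_normE le_max lexx orbT.
have affine t : a <= t <= b ->
    arc_val z t j = cons_flow G (arc_val z a j) (t - a).
  move=> /andP[at_ tb].
  apply: (@abs_continuous_affine R _ a t (fun s => arc_val z s j)) => //.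
    exact: abs_continuousW tb acab.
  apply: (@filterS _ (almost_everywhere _) _ _ _ _ aez) => x H /andP[ax xt].
  have -> : cons_flow_map G (arc_val z a j) = cons_flow_map G (arc_val z x j).
    by rewrite /cons_flow_map qE//; lra.
  by apply: is_derive_approx; apply: H; apply: slice; lra.
by split=> [|sltb]; [apply: affine|apply: inC]; rewrite as_.
Qed.

(** * Construction of the solution by iterated flows and jumps *)

(** Time of the [j]-th jump and state just after it. Once a flow never exits, [tau] is the junk
    value 0 and later entries are meaningless; [cons_arc] keeps them out of its domain. *)
Fixpoint cons_node (R : realType) (N : nat) (G : wdigraph R N) (Delta : R)
    (z0 : state R N) (j : nat) : R * state R N :=
  if j is j'.+1 then
    let: (t, z) := cons_node G Delta z0 j' in
    let tau := exit_time G Delta z in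
    (t + tau, cons_jump_map Delta (cons_flow G z tau))
  else (0, z0).

Definition jump_time (R : realType) (N : nat) (G : wdigraph R N) (Delta : R)
    (z0 : state R N) (j : nat) : R := (cons_node G Delta z0 j).1.

Definition jump_state (R : realType) (N : nat) (G : wdigraph R N) (Delta : R)
    (z0 : state R N) (j : nat) : state R N := (cons_node G Delta z0 j).2.

Definition jumps_after (R : realType) (N : nat) (G : wdigraph R N) (Delta : R)
    (z0 : state R N) (j : nat) : Prop :=
  exit_times G Delta (jump_state G Delta z0 j) !=set0.

(** The upper bound on time is imposed only if a further jump follows, so that a last slice is
    unbounded. *)
Definition cons_arc (R : realType) (N : nat) (G : wdigraph R N) (Delta : R)
    (z0 : state R N) : hybrid_arc (state R N) :=
  HybridArc
    [set p | [/\ forall k, (k < p.2)%N -> jumps_after G Delta z0 k,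
        jump_time G Delta z0 p.2 <= p.1 &
        jumps_after G Delta z0 p.2 -> p.1 <= jump_time G Delta z0 p.2.+1]]
    (fun t j =>
      cons_flow G (jump_state G Delta z0 j) (t - jump_time G Delta z0 j)).

Lemma jump_timeS (R : realType) (N : nat) (G : wdigraph R N) (Delta : R)
    (z0 : state R N) (j : nat) : jump_time G Delta z0 j.+1 =
  jump_time G Delta z0 j + exit_time G Delta (jump_state G Delta z0 j).
Proof. by rewrite /jump_time /jump_state /=; case: cons_node. Qed.

Lemma jump_stateS (R : realType) (N : nat) (G : wdigraph R N) (Delta : R)
    (z0 : state R N) (j : nat) : jump_state G Delta z0 j.+1 =
  cons_jump_map Delta (cons_flow G (jump_state G Delta z0 j)
    (exit_time G Delta (jump_state G Delta z0 j))).
Proof. by rewrite /jump_state /=; case: cons_node. Qed.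

Lemma jump_time_nd (R : realType) (N : nat) (G : wdigraph R N) (Delta : R)
    (z0 : state R N) : nondecreasing_seq (jump_time G Delta z0).
Proof.
by apply/nondecreasing_seqP => j; rewrite jump_timeS lerDl exit_time_ge0.
Qed.

(** Membership in the flow set starts after the first jump: [z0] may lie on the boundary of its
    cell, which is why the first slice can be a single point. *)
Lemma closed_cell_jump_state (R : realType) (N : nat) (G : wdigraph R N)
    (Delta : R) (z0 : state R N) (j : nat) :
  0 < Delta -> closed_cell Delta z0 ->
  closed_cell Delta (jump_state G Delta z0 j) /\
  cons_flow_set Delta (jump_state G Delta z0 j.+1).
Proof.
move=> D0 cz0.
have cell k : closed_cell Delta (jump_state G Delta z0 k) ->
    cons_flow_set Delta (jump_state G Delta z0 k.+1).
  move=> cell; rewrite jump_stateS; apply: cons_jump_flow_set => //.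
  exact: closed_cell_exit.
suff cellj : closed_cell Delta (jump_state G Delta z0 j).
  by split=> //; exact: cell.
elim: j => // k /cell[zS zi]; split=> // i.
by case/andP: (zi i) => /ltW-> /ltW->.
Qed.

(** The index [J] is the least one without a further jump; the two cases give the infinite and the
    finite form of a hybrid time domain. *)
Lemma jumps_forever_or_last (R : realType) (N : nat) (G : wdigraph R N)
    (Delta : R) (z0 : state R N) :
  (forall j, jumps_after G Delta z0 j) \/
  exists J, ~ jumps_after G Delta z0 J /\
    forall k, (k < J)%N -> jumps_after G Delta z0 k.
Proof.
have [|/existsNP[j0 nj0]] := pselect (forall j, jumps_after G Delta z0 j).
  by left.
have exJ : exists j, `[< ~ jumps_after G Delta z0 j >].
  by exists j0; apply/asboolP.
have [J /asboolP nJ minJ] := ex_minnP exJ.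
right; exists J; split=> // k kJ; apply: contrapT => /asboolP /minJ.
by rewrite leqNgt kJ.
Qed.

(** * The constructed arc is a nontrivial complete solution *)

Lemma cons_arc_domain (R : realType) (N : nat) (G : wdigraph R N)
    (Delta : R) (z0 : state R N) :
  hybrid_time_domain (arc_dom (cons_arc G Delta z0)).
Proof.
exists (jump_time G Delta z0); split=> //; first exact: jump_time_nd.
have [live|[J [nJ live]]] := jumps_forever_or_last G Delta z0.
  left; apply/seteqP; split=> -[t j] /=.
    move=> [_ t0 t1]; exists j => //; split=> //=; rewrite in_itv/= t0.
    exact: t1.
  by move=> [k _ [/= + /= jk]]; rewrite -jk in_itv/= => /andP[t0 t1]; split.
right.
exists J, `[jump_time G Delta z0 J, +oo[%classic; split; first exact: Or33.
apply/seteqP; split=> -[t j] /=.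
  move=> [alive t0 t1]; have [jJ|Jj|jJ] := ltngtP j J.
  - left; exists j => //; split=> //=; rewrite in_itv/= t0; apply: t1.
    exact: live.
  - by have := nJ (alive _ Jj).
  - by right; split=> //=; rewrite in_itv/= andbT -jJ.
move=> [[k /= kJ [/= + /= jk]]|[/= + /= jJ]].
  move: kJ; rewrite -jk in_itv/= => jJ /andP[t0 t1]; split=> // k' k'j.
  by apply: live; apply: ltn_trans jJ.
by rewrite in_itv/= andbT jJ => t0; split.
Qed.

Lemma cons_arc_flow_set (R : realType) (N : nat) (G : wdigraph R N)
    (Delta : R) (z0 : state R N) (t : R) (j : nat) :
  jump_time G Delta z0 j <= t ->
  (jumps_after G Delta z0 j -> t < jump_time G Delta z0 j.+1) ->
  cons_flow_set Delta (arc_val (cons_arc G Delta z0) t j).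
Proof.
move=> t0 t1; apply: flow_before_exit; first by rewrite subr_ge0.
by move=> /t1; rewrite jump_timeS ltrBlDl.
Qed.

Lemma cons_arc_exit (R : realType) (N : nat) (G : wdigraph R N)
    (Delta : R) (z0 : state R N) (j : nat) : jumps_after G Delta z0 j ->
  ~ cons_flow_set Delta
      (arc_val (cons_arc G Delta z0) (jump_time G Delta z0 j.+1) j).
Proof. by rewrite /= jump_timeS addrAC subrr add0r => /exit_timeP[]. Qed.

Lemma cons_arc_jump (R : realType) (N : nat) (G : wdigraph R N)
    (Delta : R) (z0 : state R N) (j : nat) :
  cons_jump_map Delta
    (arc_val (cons_arc G Delta z0) (jump_time G Delta z0 j.+1) j) =
  jump_state G Delta z0 j.+1.
Proof. by rewrite jump_stateS /= jump_timeS addrAC subrr add0r. Qed.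

Lemma is_derive_affine (R : realType) (V : normedModType R) (z w : V)
    (a t : R) : is_derive t (1 : R) (fun s => z + (s - a) *: w) w.
Proof.
have dE h : h != 0 :> R ->
    h^-1 *: ((z + (h *: 1 + t - a) *: w) - (z + (t - a) *: w)) = w.
  move=> h0; rewrite opprD addrACA subrr add0r -scalerBl [h *: 1]mulr1.
  have -> : h + t - a - (t - a) = h by lra.
  by rewrite scalerA mulVf// scale1r.
have cw : (fun h => h^-1 *: ((z + (h *: 1 + t - a) *: w) -
     (z + (t - a) *: w))) @ (0 : R)^' --> w.
  apply: (@cvg_trans _ (cst w @ (0 : R)^')); last exact: cvg_cst.
  apply: near_eq_cvg; near=> h; rewrite dE//; near: h.
  exact: nbhs_dnbhs_neq.
by apply: DeriveDef; [apply/cvg_ex; exists w | exact: cvg_lim].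
Unshelve. all: by end_near. Qed.

Lemma abs_continuous_lipschitz (R : realType) (V : normedModType R) (a b k : R)
    (f : R -> V) : 0 <= k ->
  (forall u v, u <= v -> `|f v - f u| <= k * (v - u)) -> abs_continuous a b f.
Proof.
(* The [+ 1] keeps the divisor positive when [k = 0]. *)
move=> k0 lip e e0; exists (e / (k + 1)); first by rewrite divr_gt0// ltr_wpDl.
move=> n u v uv _ len.
have le1 : \sum_i `|f (v i) - f (u i)| <= k * \sum_i (v i - u i).
  by rewrite mulr_sumr; apply: ler_sum => i _; apply: lip; case: (uv i).
have ge0 : 0 <= \sum_i (v i - u i).
  by apply: sumr_ge0 => i _; rewrite subr_ge0; case: (uv i).
move: len; rewrite ltr_pdivlMr ?ltr_wpDl//; lra.
Qed.

Lemma cons_arc_solution (R : realType) (N : nat) (G : wdigraph R N)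
    (Delta : R) (z0 : state R N) : 0 < Delta -> closed_cell Delta z0 ->
  solution (consensus_system G Delta) (cons_arc G Delta z0).
Proof.
move=> D0 cz0; set z := cons_arc G Delta z0; split.
- exact: cons_arc_domain.
- split; first by split=> // _; rewrite jump_timeS lerDl exit_time_ge0.
  rewrite /z/= /jump_time/= subrr cons_flow0 /cons_jump_set.
  have [|nC] := pselect (cons_flow_set Delta z0); [by left | right; split=> //].
  by case: cz0.
- move=> j a b _.
  apply: (@abs_continuous_lipschitz _ _ _ _
    `|cons_flow_map G (jump_state G Delta z0 j)|) => // u v uv.
  rewrite /= /cons_flow opprD addrACA subrr add0r -scalerBl normrZ mulrC.
  by rewrite opprB addrA subrK ger0_norm ?subr_ge0.
- move=> j _; split.
    apply: aeW => t _; rewrite /= cons_flow_map_flow; exact: is_derive_affine.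
  (* Being strictly below the supremum yields a later point [s] of the slice, so [t] precedes the
     next jump strictly. *)
  move=> t tinf tsup; have [_ [s /= [_ _ s1] <-] ts] := ereal_sup_gt tsup.
  apply: cons_arc_flow_set.
    rewrite -lee_fin; apply: le_trans tinf.
    by apply: le_ereal_inf_tmp => _ [u [_ u0 _] <-]; rewrite lee_fin.
  by rewrite lte_fin in ts => /s1; exact: lt_le_trans.
- move=> t j [/= _ _ t1] [/= alive t0 _].
  have aj : jumps_after G Delta z0 j by apply: alive.
  (* Slice [j] bounds [t] above and slice [j.+1] bounds it below by the same jump time. *)
  have -> : t = jump_time G Delta z0 j.+1.
    by apply/eqP; rewrite eq_le t0 t1.
  split; last first.
    by rewrite -[RHS]/(cons_jump_map Delta _) cons_arc_jump/= subrr cons_flow0.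
  split; last exact: cons_arc_exit.
  have [zS _] := (closed_cell_jump_state G j D0 cz0).1.
  by move=> i; rewrite cons_flow_snd; exact: zS.
Qed.

(** A first jump may occur at time 0, so the witness then differs by its jump count; otherwise the
    first slice is unbounded and contains time 1. *)
Lemma cons_arc_nontrivial (R : realType) (N : nat) (G : wdigraph R N)
    (Delta : R) (z0 : state R N) : nontrivial (cons_arc G Delta z0).
Proof.
have [J0|nJ0] := pselect (jumps_after G Delta z0 0).
  exists (jump_time G Delta z0 1, 1%N) => //=; split=> //.
    by case.
  by move=> _; exact: jump_time_nd.
by exists (1, 0%N) => [|[/eqP]]; [split=> //=; exact: ler01 | rewrite oner_eq0].
Qed.

(** With infinitely many jumps the jump count is unbounded, wherever the jump times accumulate;
    otherwise time is unbounded in the last slice. *)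
Lemma cons_arc_complete (R : realType) (N : nat) (G : wdigraph R N)
    (Delta : R) (z0 : state R N) : complete_arc (cons_arc G Delta z0).
Proof.
move=> [M [_ HM]].
have bnd p : arc_dom (cons_arc G Delta z0) p ->
    p.1 <= `|M| + 1 /\ p.2%:R <= `|M| + 1.
  move=> zp; have := HM (`|M| + 1) _ _ (ex_intro2 _ _ p zp erefl).
  rewrite /= prod_normE ge_max => /(_ _)/wrap[].
    by rewrite (le_lt_trans (ler_norm _))// ltrDl.
  by move=> /andP[/(le_trans (ler_norm _)) ? /(le_trans (ler_norm _))].
have [live|[J [nJ live]]] := jumps_forever_or_last G Delta z0.
  pose j := (Num.truncn (`|M| + 1)).+1.
  have [] := bnd (jump_time G Delta z0 j, j).
    by split=> //= _; exact: jump_time_nd.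
  by move=> _ /=; rewrite leNgt truncnS_gt.
pose t := Num.max (jump_time G Delta z0 J) (`|M| + 2).
have [|+ _] := bnd (t, J).
  by split=> //=; rewrite /t le_max lexx.
by rewrite /t /= ge_max; lra.
Qed.

(** * Forward uniqueness *)

Lemma cons_arc_forward_unique (R : realType) (N : nat) (G : wdigraph R N)
    (Delta : R) (z0 : state R N) :
  forward_unique (consensus_system G Delta) (cons_arc G Delta z0).
Proof.
set z := cons_arc G Delta z0; move=> z' sol' init.
have {}init : arc_val z' 0 0%N = z0 by rewrite init /= subrr cons_flow0.
have [dom' _ _ _ jump'] := sol'.
have [slice0 sliceS] := hybrid_time_domain_slices dom'.
(* Induction invariant: [z'] enters slice [j] at the same time and in the same state as the arc, and
   stays in this slice up to [t]. *)
pose reached j t := [/\ jump_time G Delta z0 j <= t,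
  forall s, jump_time G Delta z0 j <= s <= t -> arc_dom z' (s, j),
  arc_val z' (jump_time G Delta z0 j) j = jump_state G Delta z0 j &
  forall k, (k < j)%N -> jumps_after G Delta z0 k].
have agree j t : reached j t ->
    arc_dom z (t, j) /\ arc_val z' t j = arc_val z t j.
  move=> [Tt slice valT alive].
  have seg s : jump_time G Delta z0 j <= s <= t ->
      arc_val z' s j = arc_val z s j /\
      (s < t -> cons_flow_set Delta (arc_val z' s j)).
    move=> Tst; have [vs Cs] := solution_segment sol' Tt slice Tst.
    by split=> //; rewrite vs valT.
  have Ttt : jump_time G Delta z0 j <= t <= t by rewrite Tt lexx.
  split; last exact: (seg t Ttt).1.
  (* If [t] exceeded the next jump time, [z'] would still be in the flow set at that time, where the
     common value has already left it. *)
  split=> //= aj; rewrite leNgt; apply/negP => T1t.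
  have [|vE /(_ T1t)] := seg (jump_time G Delta z0 j.+1).
    by rewrite jump_time_nd//= ltW.
  by rewrite vE; exact: cons_arc_exit.
suff reach j t : arc_dom z' (t, j) -> reached j t.
  by split=> [[t j]|t j] /reach/agree[].
elim: j t => [|j IH] t z't.
  by have [t0 ht] := slice0 _ z't; split=> //.
have [b [bt z'b ht]] := sliceS _ _ z't.
have rb := IH b z'b; have [zb valb] := agree _ _ rb.
have z'b1 : arc_dom z' (b, j.+1) by apply: ht; rewrite lexx.
have [Db] := jump' _ _ z'b z'b1.
(* A jump of [z'] at [b] puts the common state outside the flow set, while the arc is inside
   strictly before its own next jump; hence [b] is that jump time. *)
have {Db} : ~ cons_flow_set Delta (arc_val z b j) by rewrite -valb; case: Db.
case: zb rb => /= alive Tb bT1 _ nC.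
have aj : jumps_after G Delta z0 j.
  by apply: contrapT => naj; apply: nC; exact: cons_arc_flow_set.
have bE : b = jump_time G Delta z0 j.+1.
  apply/eqP; rewrite eq_le bT1//= leNgt; apply/negP => bT.
  by apply: nC; exact: cons_arc_flow_set.
rewrite valb -[cons_jump_map _ _]/(cons_jump_map Delta _) bE cons_arc_jump => val1.
split=> //; rewrite -?bE //.
by move=> k; rewrite ltnS leq_eqVlt => /predU1P[->|/alive].
Qed.

(** * Existence, uniqueness and nondegenerate flow intervals *)

Theorem lemma5 (R : realType) (N : nat) (G : wdigraph R N) (Delta : R)
    (hconn : weakly_connected G) (hbal : weight_balanced G)
    (hDelta : 0 < Delta) (z0 : state R N) (hz0 : initial_states Delta z0) :
  exists z : hybrid_arc (state R N),
    [/\ solution (consensus_system G Delta) z /\ arc_val z 0 0%N = z0,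
        nontrivial z,
        complete_arc z,
        forward_unique (consensus_system G Delta) z
      & forall j : nat, j <> 0%N -> arc_slice z j !=set0 ->
          (arc_slice z j)° !=set0].
Proof.
have cz0 := initial_closed_cell hz0.
exists (cons_arc G Delta z0); split.
- split; first exact: cons_arc_solution.
  by rewrite /= subrr cons_flow0.
- exact: cons_arc_nontrivial.
- exact: cons_arc_complete.
- exact: cons_arc_forward_unique.
move=> [//|j] _ [_ [/= alive _ _]].
pose T := jump_time G Delta z0.
(* The slice contains the open interval from [T j.+1] to [u]. Here [u] is the next jump time,
   strictly later because a jumped state lies in the flow set, or [T j.+1 + 1] if no jump
   follows. *)
have [u Tu uT] : exists2 u, T j.+1 < u &
    jumps_after G Delta z0 j.+1 -> u <= T j.+2.
  have [aj|naj] := pselect (jumps_after G Delta z0 j.+1).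
    exists (T j.+2) => //; rewrite /T (jump_timeS _ _ _ j.+1) ltrDl.
    exact: exit_time_gt0 (closed_cell_jump_state G j hDelta cz0).2 aj.
  by exists (T j.+1 + 1) => //; rewrite ltrDl.
exists ((T j.+1 + u) / 2).
have mid : (T j.+1 + u) / 2 \in `]T j.+1, u[ by rewrite in_itv/=; lra.
apply: filterS (near_in_itvoo mid) => s; rewrite in_itv/= => /andP[Ts su].
split=> //=; first exact: ltW.
by move=> /uT; apply: le_trans; exact: ltW.
Qed.
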